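(* There is an algorithm that, given a finite strongly connected directed graph $G=(V,E)$, returns the cut graph $C_1(G)$ (that is, decides for every pair of distinct nodes of $V$ whether they are in an S-product-form relationship) in time $O(|V|^2|E|)$.
   Context: A finite directed graph is a pair $G=(V,E)$ with $V$ finite and $E\subseteq V\times V$; it is encoded by giving, for each node, the list of its direct predecessors. Time is measured in elementary operations of the standard RAM model. A formal Markov chain is a strongly connected directed graph $G=(V,E)$ together with free variables $q_{u,v}$, $(u,v)\in E$, taking positive real values (transition rates, or transition probabilities with $\sum_vq_{u,v}=1$ for each $u$). Its stationary distribution $\pi$ is the solution, as a function of the $q_{u,v}$, of $\pi_u\sum_{v:(u,v)\in E}q_{u,v}=\sum_{v:(v,u)\in E}\pi_vq_{v,u}$ for all $u\in V$ and $\sum_u\pi_u=1$. Let $N_u=\{v:(u,v)\in E\}$. Nodes $i\neq j$ are in an S-product-form relationship if there are nonempty $S_{i,j}\subseteq N_i$ and $S_{j,i}\subseteq N_j$ such that $\pi_i\sum_{k\in S_{i,j}}q_{i,k}=\pi_j\sum_{k\in S_{j,i}}q_{j,k}$ for all values of the variables. The cut graph $C_1(G)$ is the undirected graph on $V$ whose edges are the pairs $\{i,j\}$ of distinct nodes in an S-product-form relationship. *)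

(* Defs.v *)
From mathcomp Require Import all_boot all_order all_algebra.
From mathcomp Require Import boolp reals.

Set Implicit Arguments.
Unset Strict Implicit.
Unset Printing Implicit Defensive.

Import GRing.Theory Num.Theory.
Local Open Scope ring_scope.

(* Directed graphs on the vertex set {0, .., n-1}; loops are allowed. *)
Definition digraph (n : nat) := {set 'I_n * 'I_n}.

Definition strongly_connected n (E : digraph n) : Prop :=
  forall u v : 'I_n, connect (fun x y => (x, y) \in E) u v.

Definition out_neighbours n (E : digraph n) (u : 'I_n) : {set 'I_n} :=
  [set v | (u, v) \in E].

(* The free variables of a formal Markov chain are either the transition rates
   of a continuous-time chain or the transition probabilities of a
   discrete-time one. *)
Variant chain_kind := Rates | Probabilities.

(* Only the values q u v with (u, v) \in E are meaningful. *)
Definition valuation (R : realType) (k : chain_kind) n (E : digraph n)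
    (q : 'I_n -> 'I_n -> R) : Prop :=
  (forall u v, (u, v) \in E -> 0 < q u v) /\
  match k with
  | Rates => True
  | Probabilities => forall u, \sum_(v in out_neighbours E u) q u v = 1
  end.

Definition stationary (R : realType) n (E : digraph n)
    (q : 'I_n -> 'I_n -> R) (pi : 'I_n -> R) : Prop :=
  (forall u, pi u * (\sum_(v | (u, v) \in E) q u v) =
             \sum_(v | (v, u) \in E) pi v * q v u) /\
  \sum_u pi u = 1.

(* For a strongly connected graph the stationary distribution of a valuation
   exists and is unique, so quantifying over all pi satisfying [stationary]
   quantifies over exactly that distribution. *)
Definition S_product_form (R : realType) (k : chain_kind) n (E : digraph n)
    (i j : 'I_n) : Prop :=
  exists Sij Sji : {set 'I_n},
    [/\ Sij != set0, Sij \subset out_neighbours E i,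
        Sji != set0, Sji \subset out_neighbours E j &
        forall (q : 'I_n -> 'I_n -> R) (pi : 'I_n -> R),
          valuation k E q -> stationary E q pi ->
          pi i * (\sum_(v in Sij) q i v) = pi j * (\sum_(v in Sji) q j v)].

(* Adjacency relation of C_1(G). *)
Definition cut_graph (R : realType) (k : chain_kind) n (E : digraph n) :
    rel 'I_n :=
  fun i j => (i != j) && `[< S_product_form R k E i j >].

Local Close Scope ring_scope.

(* The unit-cost random access machine of Cook and Reckhow: an unbounded array
   of registers, indirect addressing, an input tape and an output tape. There
   is no multiplication, so that charging one time unit per instruction is
   reasonable although registers are unbounded. Registers hold natural numbers
   and subtraction is truncated. *)
Variant instr :=
  | IConst of nat & nat       (* IConst i c   : X_i <- c             *)
  | IAdd of nat & nat & nat   (* IAdd i j k   : X_i <- X_j + X_k     *)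
  | ISub of nat & nat & nat   (* ISub i j k   : X_i <- X_j - X_k     *)
  | IFetch of nat & nat       (* IFetch i j   : X_i <- X_(X_j)       *)
  | IStore of nat & nat       (* IStore i j   : X_(X_i) <- X_j       *)
  | IJumpPos of nat & nat     (* IJumpPos l j : if X_j > 0 goto l    *)
  | IRead of nat              (* IRead i      : X_i <- next input    *)
  | IWrite of nat.            (* IWrite i     : append X_i to output *)

Definition program := seq instr.

Record state := State {
  pc : nat;
  reg : nat -> nat;
  input : seq nat;
  output : seq nat
}.

Definition upd (X : nat -> nat) (a x : nat) : nat -> nat :=
  fun b => if b == a then x else X b.

(* Reading past the end of the input yields 0. *)
Definition exec (c : instr) (s : state) : state :=
  let: State p X inp out := s in
  match c with
  | IConst i x => State p.+1 (upd X i x) inp out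
  | IAdd i j k => State p.+1 (upd X i (X j + X k)) inp out
  | ISub i j k => State p.+1 (upd X i (X j - X k)) inp out
  | IFetch i j => State p.+1 (upd X i (X (X j))) inp out
  | IStore i j => State p.+1 (upd X (X i) (X j)) inp out
  | IJumpPos l j => State (if 0 < X j then l else p.+1) X inp out
  | IRead i => State p.+1 (upd X i (head 0 inp)) (behead inp) out
  | IWrite i => State p.+1 X inp (rcons out (X i))
  end.

(* The machine has halted once pc points outside the program; a halted state
   is a fixed point of [step]. *)
Definition step (P : program) (s : state) : state :=
  if onth P (pc s) is Some c then exec c s else s.

Definition init (w : seq nat) : state := State 0 (fun=> 0) w [::].

(* P, started on input w, halts after executing at most t instructions, having
   written exactly the sequence r. *)
Definition computes_within (P : program) (w : seq nat) (t : nat)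
    (r : seq nat) : Prop :=
  let s := iter t (step P) (init w) in size P <= pc s /\ output s = r.

(* The predecessors of each node may be listed in any order. *)
Definition predecessor_lists n (E : digraph n) (pl : 'I_n -> seq 'I_n) : Prop :=
  forall v, uniq (pl v) /\ (forall u, (u \in pl v) = ((u, v) \in E)).

(* n, followed for each node by the length of its list and the list itself. *)
Definition encode_graph n (pl : 'I_n -> seq 'I_n) : seq nat :=
  n :: flatten [seq size (pl v) :: [seq val u | u <- pl v] | v <- enum 'I_n].

(* The adjacency matrix in row-major order. *)
Definition encode_rel n (e : rel 'I_n) : seq nat :=
  [seq nat_of_bool (e i j) | i <- enum 'I_n, j <- enum 'I_n].

(* Main.v *)
Require Import Defs.
From mathcomp Require Import all_boot all_order all_algebra.
From mathcomp Require Import boolp reals.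
From mathcomp Require Import zify.

(** Two distinct nodes [i], [j] are in an S-product-form relationship exactly
    when the graph has a cut [L] with [i] inside, [j] outside, and such that
    every edge crossing it leaves from [i] or from [j]; the algorithm looks for
    such a cut, for each pair of nodes.

    A cut gives a product form by summing the balance equations over the nodes
    inside [L] (cut_equation). Conversely, a positive circulation [f] on the
    edges is the same thing as a valuation together with its stationary
    distribution: normalise the flow out of each node to get the transition
    probabilities, and the total flow to get [pi]. A product form thus says that
    every positive circulation carries as much flow on [i -> Sij] as on
    [j -> Sji]. Adding the indicator of a closed walk to a positive circulation
    gives another one, so every closed walk takes an edge [i -> Sij] as often
    as an edge [j -> Sji] (product_form_closed_walk). Suppose now that some node
    can reach both [i] and [j] along paths that leave neither of them before
    the end. Then some out-neighbour of [i] or [j] can too, and this yields a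
    closed walk that takes edges of one kind only (no_joint_neighbour). So there
    is no such node, and the nodes that reach [i] first form a cut
    (product_form_cut).

    To decide whether a cut exists, label [i] with 1 and [j] with 2, and search
    backwards from both, each node passing its label on to its predecessors
    other than [i] and [j]. The labels are forced by any cut, and by strong
    connectivity every node receives one, so a cut exists if and only if no
    edge with source outside [{i, j}] joins two different labels
    (labelling_complete). A search handles every node and every edge once; its
    cost is [O(n + |E|)], which is [O(|E|)] because every node of a strongly
    connected graph with at least two nodes has a predecessor.

    The machine program is compiled from a small language of blocks,
    conditionals and loops. Its correctness and its running time are proved
    together by a weakest-precondition calculus in which remaining time is part
    of the state: [wp c Q f X inp out] says that [c] ends within [f] steps in
    a state satisfying [Q], where [Q] also sees how many of the [f] steps are
    left. *)

Set Implicit Arguments.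
Unset Strict Implicit.
Unset Printing Implicit Defensive.

Import GRing.Theory Num.Theory.

(** * Cuts and product forms *)

Definition is_cut n (E : digraph n) (i j : 'I_n) (L : 'I_n -> bool) : Prop :=
  [/\ L i, ~~ L j &
      forall u v, (u, v) \in E -> u != i -> u != j -> L u = L v].

Section CutEquation.

Local Open Scope ring_scope.

(** Summing the balance equations over the inside of the cut cancels the flow
    along inner edges; only the flow through the cut is left, and it leaves from
    [i] in one direction and from [j] in the other. *)
Lemma cut_equation (R : realType) n (E : digraph n) (i j : 'I_n) L q
    (pi : 'I_n -> R) :
  is_cut E i j L -> stationary E q pi ->
  pi i * (\sum_(v | ((i, v) \in E) && ~~ L v) q i v) =
  pi j * (\sum_(v | ((j, v) \in E) && L v) q j v).
Proof.
move=> [Li Lj LE] [bal _].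
pose f u v := if (u, v) \in E then pi u * q u v else 0.
have balf u : \sum_v f u v = \sum_v f v u.
  have := bal u; rewrite mulr_sumr big_mkcond [in RHS]big_mkcond /=.
  exact.
have flow : \sum_(u | L u) \sum_(v | ~~ L v) f u v =
            \sum_(v | ~~ L v) \sum_(u | L u) f v u.
  have tot : \sum_(u | L u) \sum_v f u v = \sum_(u | L u) \sum_v f v u.
    by apply: eq_bigr => u _.
  have spl (h : 'I_n -> 'I_n -> R) : \sum_(u | L u) \sum_v h u v =
      \sum_(u | L u) \sum_(v | L v) h u v
      + \sum_(u | L u) \sum_(v | ~~ L v) h u v.
    by rewrite -big_split; apply: eq_bigr => u _; rewrite (bigID L).
  move: tot; rewrite !spl [X in _ = X + _]exchange_big /= => /addrI ->.
  by rewrite exchange_big.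
move: flow; rewrite (bigD1 i) //= [X in _ + X]big1 ?addr0; last first.
  move=> u /andP [Lu ui]; apply: big1 => v Lv; rewrite /f.
  case: ifP => // uv; have uj : u != j by apply: contraTneq Lu => ->.
  by move: Lv; rewrite -(LE _ _ uv ui uj) Lu.
rewrite [RHS](bigD1 j) //= [X in _ = _ + X]big1 ?addr0; last first.
  move=> u /andP [Lu uj]; apply: big1 => v Lv; rewrite /f.
  case: ifP => // uv; have ui : u != i by apply: contraNneq Lu => ->.
  by move: Lu; rewrite (LE _ _ uv ui uj) Lv.
rewrite !mulr_sumr => flow.
by rewrite !big_mkcondl.
Qed.

End CutEquation.

Lemma path_crosses (T : eqType) (e : rel T) (A : pred T) x p :
  path e x p -> A x -> ~~ A (last x p) -> exists y z, [/\ e y z, A y & ~~ A z].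
Proof.
elim: p x => [|y p IH] x /=; first by move=> _ ->.
case/andP=> xy yp Ax Al; case: (boolP (A y)) => Ay; first exact: IH yp Ay Al.
by exists x, y.
Qed.

Lemma cut_crossed n (E : digraph n) (A : pred 'I_n) u v :
  strongly_connected E -> A u -> ~~ A v ->
  exists x y, [/\ (x, y) \in E, A x & ~~ A y].
Proof.
by move=> /(_ u v) /connectP [p up ->] Au Av; exact: path_crosses up Au Av.
Qed.

(** The sets are the heads of the edges that cross the cut; strong connectivity
    makes both of them nonempty. *)
Lemma cut_product_form (R : realType) k n (E : digraph n) i j L :
  strongly_connected E -> is_cut E i j L -> S_product_form R k E i j.
Proof.
move=> sc cutL; have [Li Lj LE] := cutL.
exists [set v | ((i, v) \in E) && ~~ L v], [set v | ((j, v) \in E) && L v].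
split.
- have [x [y [xy Lx Ly]]] := cut_crossed sc Li Lj.
  have xi : x = i.
    apply/eqP; apply/negP => /negP xi.
    have xj : x != j by apply: contraTneq Lx => ->.
    by move: Ly; rewrite -(LE _ _ xy) ?Lx.
  by apply/set0Pn; exists y; rewrite inE -{1}xi xy.
- by apply/subsetP => v; rewrite !inE => /andP [].
- have [||x [y [xy Lx /negPn Ly]]] := @cut_crossed _ E (predC L) j i sc.
  + exact: Lj.
  + by rewrite /= Li.
  have xj : x = j.
    apply/eqP; apply/negP => /negP xj.
    have xi : x != i by apply: contraNneq Lx => ->.
    by move: Lx; rewrite /= (LE _ _ xy) ?Ly.
  by apply/set0Pn; exists y; rewrite inE -{1}xj xy.
- by apply/subsetP => v; rewrite !inE => /andP [].
move=> q pi _ st; under eq_bigl do rewrite inE.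
under [in RHS]eq_bigl do rewrite inE.
exact: cut_equation cutL st.
Qed.

(** * Closed walks and positive circulations *)

Section Circulations.

Variables (n : nat) (E : digraph n).

Let e := [rel u v : 'I_n | (u, v) \in E].

(** The walk [x :: p] as a unit flow: the number of times it takes the edge from
    [u] to [v]. *)
Fixpoint traversals (x : 'I_n) (p : seq 'I_n) (u v : 'I_n) : nat :=
  if p is y :: p' then (x == u) && (y == v) + traversals y p' u v else 0.

Lemma traversals_cat x p1 p2 u v :
  traversals x (p1 ++ p2) u v =
  traversals x p1 u v + traversals (last x p1) p2 u v.
Proof. by elim: p1 x => //= y p1 IH x; rewrite IH addnA. Qed.

Lemma traversals_supp x p u v :
  path e x p -> (u, v) \notin E -> traversals x p u v = 0.
Proof.
elim: p x => //= y p IH x /andP [xy yp] uv; rewrite (IH _ yp uv) addn0.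
by case: eqP => //= xu; case: eqP => //= yv; rewrite -xu -yv xy in uv.
Qed.

(** A walk leaves a node as often as it enters it, up to its two endpoints. *)
Lemma traversals_balance x p u :
  \sum_v traversals x p u v + (last x p == u) =
  \sum_v traversals x p v u + (x == u).
Proof.
elim: p x => [|y p IH] x /=; first by rewrite !big1.
rewrite !big_split /= -addnA IH.
have -> : \sum_v (x == u) && (y == v) = (x == u).
  rewrite (bigD1 y) //= eqxx andbT big1 ?addn0 // => v; rewrite eq_sym.
  by move/negPf->; rewrite andbF.
have -> : \sum_v (x == v) && (y == u) = (y == u).
  rewrite (bigD1 x) //= eqxx big1 ?addn0 // => v; rewrite eq_sym.
  by move/negPf->.
by rewrite addnC; congr (_ + _); rewrite addnC.
Qed.

Definition circulation (f : 'I_n -> 'I_n -> nat) : Prop :=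
  (forall u v, (u, v) \notin E -> f u v = 0) /\
  (forall u, \sum_v f u v = \sum_v f v u).

Lemma circulationD f g :
  circulation f -> circulation g -> circulation (fun u v => f u v + g u v).
Proof.
move=> [f0 fb] [g0 gb]; split=> [u v uv|u]; first by rewrite f0 ?g0.
by rewrite !big_split /= fb gb.
Qed.

Lemma circulation_closed_walk x p :
  path e x p -> last x p = x -> circulation (traversals x p).
Proof.
move=> xp lx; split=> [u v|u]; first exact: traversals_supp.
by apply/eqP; rewrite -(eqn_add2r (x == u)) -traversals_balance lx.
Qed.

(** By strong connectivity each edge lies on a closed walk, and the sum of such
    walks over all edges is positive everywhere. *)
Lemma positive_circulation :
  strongly_connected E ->
  exists2 f, circulation f & forall u v, (u, v) \in E -> 0 < f u v.
Proof.
move=> sc; suff [f cf fp] : exists2 f, circulation f &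
    forall a, a \in enum E -> 0 < f a.1 a.2.
  by exists f => // u v uv; apply: (fp (u, v)); rewrite mem_enum.
have: {subset enum E <= E} by move=> a; rewrite mem_enum.
elim: (enum E) => [_|[u v] s IH sE].
  by exists (fun _ _ => 0) => //; split=> // u; rewrite !big1.
have [|f cf fp] := IH; first by move=> a sa; apply: sE; rewrite inE sa orbT.
have uv : (u, v) \in E by apply: sE; rewrite inE eqxx.
have /connectP [p vp lp] := sc v u.
exists (fun a b => f a b + traversals u (v :: p) a b).
  by apply: circulationD => //; apply: circulation_closed_walk; rewrite //= uv.
move=> a; rewrite inE => /orP [/eqP -> /=|/fp fa]; last by rewrite addn_gt0 fa.
by rewrite !eqxx addnA addn_gt0 addn1.
Qed.

End Circulations.

(** * A product form yields a cut *)

Section Necessity.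

Variables (R : realType) (k : chain_kind) (n : nat) (E : digraph n).

Local Open Scope ring_scope.

(** With [F u] the flow out of [u] and [T] the total flow, the probabilities
    [f u v / F u] have stationary distribution [F u / T], and then
    [pi u * q u v] is [f u v / T]. This valuation is admissible both as rates
    and as probabilities. *)
Lemma product_form_circulation i j (Si Sj : {set 'I_n}) f :
  (forall (q : 'I_n -> 'I_n -> R) (pi : 'I_n -> R),
     valuation k E q -> stationary E q pi ->
     pi i * (\sum_(v in Si) q i v) = pi j * (\sum_(v in Sj) q j v)) ->
  circulation E f -> (forall u v, (u, v) \in E -> (0 < f u v)%N) ->
  (forall u, exists v, (u, v) \in E) ->
  (\sum_(v in Si) f i v = \sum_(v in Sj) f j v)%N.
Proof.
move=> H [f0 fb] fp out.
pose F u := (\sum_v f u v)%N.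
have Fp u : (0 < F u)%N.
  by have [v uv] := out u; rewrite /F (bigD1 v) //= addn_gt0 fp.
pose T := (\sum_u F u)%N.
have Tp : (0 < T)%N by rewrite /T (bigD1 i) //= addn_gt0 Fp.
have T0 : T%:R != 0 :> R by rewrite pnatr_eq0 -lt0n.
have F0 u : (F u)%:R != 0 :> R by rewrite pnatr_eq0 -lt0n.
pose q u v : R := (f u v)%:R / (F u)%:R.
pose pi u : R := (F u)%:R / T%:R.
have piq u v : pi u * q u v = (f u v)%:R / T%:R.
  by rewrite /pi /q mulrC -mulrA mulKf.
have q1 u : \sum_(v | (u, v) \in E) q u v = 1.
  have -> : \sum_(v | (u, v) \in E) q u v = \sum_v q u v.
    rewrite big_mkcond; apply: eq_bigr => v _; case: ifPn => // /f0.
    by rewrite /q => ->; rewrite mulr0n mul0r.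
  by rewrite /q -mulr_suml -natr_sum (divff (F0 u)).
have val : valuation k E q.
  split=> [u v uv|]; first by rewrite /q divr_gt0 ?ltr0n ?fp.
  by case: k => // u; rewrite -(q1 u); apply: eq_bigl => v; rewrite inE.
have st : stationary E q pi.
  split=> [u|]; last by rewrite /pi -mulr_suml -natr_sum divff.
  rewrite q1 mulr1 /pi /F fb natr_sum mulr_suml [RHS]big_mkcond /=.
  apply: eq_bigr => v _; rewrite piq.
  by case: ifPn => // /f0 ->; rewrite mulr0n mul0r.
have flow u (S : {set 'I_n}) :
    pi u * \sum_(v in S) q u v = (\sum_(v in S) f u v)%N%:R / T%:R.
  by rewrite mulr_sumr natr_sum mulr_suml; apply: eq_bigr => v _.
have := H q pi val st; rewrite !flow => /mulIf.
by rewrite invr_eq0 => /(_ T0) /eqP; rewrite eqr_nat => /eqP.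
Qed.

Local Close Scope ring_scope.

Let e := [rel u v : 'I_n | (u, v) \in E].

(** Compare a positive circulation with its sum with the flow of the walk. *)
Lemma product_form_closed_walk i j (Si Sj : {set 'I_n}) :
  strongly_connected E -> i != j ->
  (forall (q : 'I_n -> 'I_n -> R) (pi : 'I_n -> R),
     valuation k E q -> stationary E q pi ->
     (pi i * (\sum_(v in Si) q i v) = pi j * (\sum_(v in Sj) q j v))%R) ->
  forall x p, path e x p -> last x p = x ->
  \sum_(v in Si) traversals x p i v = \sum_(v in Sj) traversals x p j v.
Proof.
move=> sc ij H x p xp lp.
have out u : exists v, (u, v) \in E.
  have [w uw] : exists w, w != u.
    by case: (eqVneq i u) => iu; [exists j; rewrite -iu eq_sym | exists i].
  have [a [b [ab /eqP au _]]] := @cut_crossed _ E (pred1 u) u w sc (eqxx u) uw.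
  by exists b; rewrite -au.
have [f cf fp] := positive_circulation sc.
have e0 := product_form_circulation H cf fp out.
have cw := circulationD cf (circulation_closed_walk xp lp).
have := product_form_circulation H cw _ out; rewrite !big_split /= e0.
by move=> /(_ _) /addnI; apply=> a b /fp fab; rewrite addn_gt0 fab.
Qed.

(** A path for this relation may end at [i] or [j] but never leaves them, so
    [connect (internal i j) x i] says that [x] has a path to [i] avoiding [j]. *)
Definition internal (i j : 'I_n) : rel 'I_n :=
  [rel u v | [&& (u, v) \in E, u != i & u != j]].

Lemma internalC i j : internal i j =2 internal j i.
Proof. by move=> u v; congr andb; rewrite andbC. Qed.

Lemma internal_path i j x p : path (internal i j) x p -> path e x p.
Proof. by apply: sub_path => u v /andP []. Qed.

Lemma internal_traversals i j x p v :
  path (internal i j) x p ->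
  traversals x p i v = 0 /\ traversals x p j v = 0.
Proof.
elim: p x => //= y p IH x /andP [/and3P [_ /negPf -> /negPf ->] yp].
exact: IH yp.
Qed.

Lemma internal_exit i j x :
  strongly_connected E ->
  connect (internal i j) x i \/ connect (internal i j) x j.
Proof.
move=> sc; have /connectP [p xp lp] := sc x i.
elim: p x xp lp => [x _ ->|y p IH x /= /andP [xy yp] lp]; first by left.
case: (eqVneq x i) => [->|xi]; first by left.
case: (eqVneq x j) => [->|xj]; first by right.
have xy' : connect (internal i j) x y by apply: connect1; apply/and3P.
by case: (IH y yp lp) => [yi|yj]; [left|right]; apply: connect_trans xy' _.
Qed.

(** Let [b] be an out-neighbour of [i] with internal paths to both [i] and [j].
    If [b] is in [Si], the closed walk [i -> b ~> i] uses [Si] but never leaves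
    [j]. Otherwise take [u] in [Sj]. If [u] has an internal path to [j], the
    closed walk [j -> u ~> j] uses [Sj] but never leaves [i]; if it has one to
    [i], then [i -> b ~> j -> u ~> i] uses [Sj] once and [Si] never. *)
Lemma no_joint_neighbour i j (Si Sj : {set 'I_n}) b :
  strongly_connected E -> i != j ->
  Sj != set0 -> Sj \subset out_neighbours E j ->
  (forall x p, path e x p -> last x p = x ->
     \sum_(v in Si) traversals x p i v = \sum_(v in Sj) traversals x p j v) ->
  (i, b) \in E ->
  ~ (connect (internal i j) b i /\ connect (internal i j) b j).
Proof.
move=> sc ij /set0Pn [u Su] /subsetP sSj H ib.
case=> /connectP [p bp pi] /connectP [p' bp' pj].
have ju : (j, u) \in E by have := sSj _ Su; rewrite inE.
have one (S : {set 'I_n}) w : w \in S -> 0 < \sum_(v in S) (w == v : nat).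
  by move=> Sw; rewrite (bigD1 w) //= eqxx.
case: (boolP (b \in Si)) => bS.
  have /= := H i (b :: p); rewrite ib (internal_path bp) -pi eqxx.
  rewrite (negPf ij) => /(_ isT erefl).
  rewrite big_split [in RHS]big1 /=; last first.
    by move=> v _; have [_ ->] := internal_traversals v bp.
  move=> /eqP; rewrite addn_eq0 => /andP [/eqP h _].
  by have := one _ _ bS; rewrite h.
case: (internal_exit i j u sc) => /connectP [r ur rl].
- have /= := H i (b :: p' ++ u :: r).
  rewrite ib cat_path (internal_path bp') /= -pj ju (internal_path ur).
  rewrite last_cat /= -rl eqxx (negPf ij) => /(_ isT erefl).
  rewrite big1 /=; last first.
    move=> v vS; rewrite traversals_cat /= -pj [j == i]eq_sym (negPf ij) /=.
    have [-> _] := internal_traversals v bp'.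
    have [-> _] := internal_traversals v ur.
    by case: eqP => // bv; rewrite bv vS in bS.
  under eq_bigr do rewrite add0n traversals_cat /= -pj eqxx /= addnCA.
  rewrite big_split /= => /esym /eqP; rewrite addn_eq0 => /andP [/eqP h _].
  by have := one _ _ Su; rewrite h.
- have /= := H j (u :: r); rewrite ju (internal_path ur) -rl eqxx.
  rewrite eq_sym (negPf ij) => /(_ isT erefl).
  rewrite big1 /=; last by move=> v _; have [-> _] := internal_traversals v ur.
  rewrite big_split /= => /esym /eqP; rewrite addn_eq0 => /andP [/eqP h _].
  by have := one _ _ Su; rewrite h.
Qed.

Lemma product_form_cut i j :
  strongly_connected E -> i != j -> S_product_form R k E i j ->
  exists L, is_cut E i j L.
Proof.
move=> sc ij [Si [Sj [Si0 sSi Sj0 sSj H]]].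
have Hw := product_form_closed_walk sc ij H.
have ji : j != i by rewrite eq_sym.
pose c := connect (internal i j).
have nji b : (j, b) \in E -> ~ (c b i /\ c b j).
  rewrite /c !(eq_connect (internalC i j)) => jb [bi bj].
  apply: (no_joint_neighbour sc ji Si0 sSi _ jb) => [x p xp lp|]; last by split.
  by rewrite Hw.
have stuck x y : (x == i) || (x == j) -> c x y -> x = y.
  move=> xij /connectP [[|z p] //= /andP [/and3P [_ xi xj] _] _].
  by rewrite (negPf xi) (negPf xj) in xij.
(* A path from [i] to a node with internal paths to both [i] and [j] enters the
   set of such nodes; the edge by which it does so must start at [i] or [j]. *)
have nJ u : ~~ (c u i && c u j).
  apply/negP => Ju.
  have [||x [y [xy Jx /negPn /andP Jy]]] :=
      @cut_crossed _ E (fun v => ~~ (c v i && c v j)) i u sc.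
  - apply/negP => /andP [_ /stuck]; rewrite eqxx => /(_ isT) /eqP.
    by rewrite (negPf ij).
  - by rewrite Ju.
  case: (eqVneq x i) => [xi|xi].
    by apply: (no_joint_neighbour sc ij Sj0 sSj Hw _ Jy); rewrite -xi.
  case: (eqVneq x j) => [xj|xj]; first by case: (nji y); rewrite -?xj // xj.
  have xy' : c x y by apply: connect1; apply/and3P.
  case: Jy => yi yj; case/negP: Jx.
  by rewrite /c !(connect_trans xy').
exists (fun v => c v i); split; first exact: connect0.
  apply/negP => /stuck; rewrite eqxx orbT => /(_ isT) /eqP.
  by rewrite (negPf ji).
move=> u v uv ui uj; have uv' : c u v by apply: connect1; apply/and3P.
apply/idP/idP => [cui|]; last exact: connect_trans uv'.
case: (internal_exit i j v sc) => // vj.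
by have := nJ u; rewrite cui /c (connect_trans uv' vj).
Qed.

End Necessity.

Lemma cut_graphP (R : realType) k n (E : digraph n) i j :
  strongly_connected E -> i != j ->
  cut_graph R k E i j <-> exists L, is_cut E i j L.
Proof.
move=> sc ij; rewrite /cut_graph ij /=; split=> [/asboolP|[L cutL]].
  exact: product_form_cut.
by apply/asboolP; exact: cut_product_form cutL.
Qed.

(** * A structured language compiled to the machine *)

Inductive cmd :=
  | Block of seq instr
  | Seq of cmd & cmd
  | If of nat & cmd & cmd
  | While of nat & cmd.

Definition straight (c : instr) : bool :=
  if c is IJumpPos _ _ then false else true.

Fixpoint csize (c : cmd) : nat :=
  match c with
  | Block b => size b
  | Seq c1 c2 => csize c1 + csize c2
  | If _ c1 c2 => csize c2 + csize c1 + 3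
  | While _ c => csize c + 3
  end.

(** The machine has no unconditional jump: register 0 is reserved for the
    constant 1 that is loaded before a jump that must be taken. A loop is
    entered by jumping to the test at its end. *)
Fixpoint compile (p : nat) (c : cmd) : program :=
  match c with
  | Block b => b
  | Seq c1 c2 => compile p c1 ++ compile (p + csize c1) c2
  | If r c1 c2 =>
      IJumpPos (p + csize c2 + 3) r :: compile p.+1 c2 ++
      [:: IConst 0 1; IJumpPos (p + csize c2 + csize c1 + 3) 0] ++
      compile (p + csize c2 + 3) c1
  | While r c =>
      [:: IConst 0 1; IJumpPos (p + csize c + 2) 0] ++
      compile (p + 2) c ++ [:: IJumpPos (p + 2) r]
  end.

Lemma size_compile p c : size (compile p c) = csize c.
Proof.
elim: c p => //= [c1 IH1 c2 IH2|r c1 IH1 c2 IH2|r c IH] p.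
- by rewrite size_cat IH1 IH2.
- by rewrite !size_cat /= IH1 IH2; lia.
- by rewrite size_cat /= IH; lia.
Qed.

(** The first argument of an assertion is the number of steps still
    available. *)
Definition assertion := nat -> (nat -> nat) -> seq nat -> seq nat -> Prop.

Definition code_at (P : program) (p : nat) (b : program) : Prop :=
  exists pre post, P = pre ++ b ++ post /\ size pre = p.

Definition wp (c : cmd) (Q : assertion) : assertion := fun f X inp out =>
  forall P p, code_at P p (compile p c) ->
  exists t X' inp' out',
    [/\ t <= f,
        iter t (step P) (State p X inp out) =
        State (p + csize c) X' inp' out' &
        Q (f - t) X' inp' out'].

Lemma code_at_cat P p b1 b2 :
  code_at P p (b1 ++ b2) ->
  code_at P p b1 /\ code_at P (p + size b1) b2.
Proof.
case=> pre [post [-> <-]]; split.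
  by exists pre, (b2 ++ post); rewrite !catA.
by exists (pre ++ b1), post; rewrite size_cat !catA.
Qed.

Lemma step_at P p c b X inp out :
  code_at P p (c :: b) ->
  step P (State p X inp out) = exec c (State p X inp out).
Proof.
case=> pre [post [-> <-]]; rewrite /step /=.
have -> : onth (pre ++ (c :: b) ++ post) (size pre) = Some c by elim: pre.
by [].
Qed.

Lemma wp_seq c1 c2 Q f X inp out :
  wp c1 (wp c2 Q) f X inp out -> wp (Seq c1 c2) Q f X inp out.
Proof.
move=> H P p /= /code_at_cat []; rewrite size_compile => cP1 cP2.
have [t1 [X1 [inp1 [out1 [tf1 it1 H1]]]]] := H _ _ cP1.
have [t2 [X2 [inp2 [out2 [tf2 it2 H2]]]]] := H1 _ _ cP2.
exists (t2 + t1), X2, inp2, out2; split; first by lia.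
  by rewrite iterD it1 it2 addnA.
by rewrite addnC subnDA.
Qed.

(** The effect of a straight-line instruction on everything but the program
    counter. *)
Definition exec_mem (c : instr) (m : (nat -> nat) * seq nat * seq nat) :=
  let: (X, inp, out) := m in
  match c with
  | IConst i x => (upd X i x, inp, out)
  | IAdd i j k => (upd X i (X j + X k), inp, out)
  | ISub i j k => (upd X i (X j - X k), inp, out)
  | IFetch i j => (upd X i (X (X j)), inp, out)
  | IStore i j => (upd X (X i) (X j), inp, out)
  | IJumpPos l j => m
  | IRead i => (upd X i (head 0 inp), behead inp, out)
  | IWrite i => (X, inp, rcons out (X i))
  end.

Fixpoint block_post (b : seq instr) (Q : assertion) : assertion :=
  fun f X inp out =>
  if b is c :: b' then
    let: (X', inp', out') := exec_mem c (X, inp, out) in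
    block_post b' Q f X' inp' out'
  else Q f X inp out.

Lemma wp_block b Q f X inp out :
  all straight b -> size b <= f ->
  block_post b Q (f - size b) X inp out -> wp (Block b) Q f X inp out.
Proof.
move=> wb sf H P p /= cP.
suff [X' [inp' [out' [it q]]]] : exists X' inp' out',
    iter (size b) (step P) (State p X inp out) =
      State (p + size b) X' inp' out' /\ Q (f - size b) X' inp' out'.
  by exists (size b), X', inp', out'; split.
move: (f - size b) H => g.
elim: b X inp out p wb {sf} cP => [|c b IH] X inp out p.
  by move=> _ _ H; exists X, inp, out; rewrite addn0.
move=> /andP [sc wb] cP; have /= [_ cPb] := @code_at_cat _ _ [:: c] _ cP.
move=> H; rewrite addn1 in cPb.
have [X' [inp' [out' [st q]]]] : exists X' inp' out',
    step P (State p X inp out) = State p.+1 X' inp' out' /\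
    block_post b Q g X' inp' out'.
  rewrite (step_at _ _ _ cP).
  by case: c sc H {cP} => //= *; do 3 eexists; split.
have [X2 [inp2 [out2 [it q2]]]] := IH _ _ _ _ wb cPb q.
by exists X2, inp2, out2; rewrite -iterS iterSr st it addSnnS.
Qed.

(** The second branch ends with the jump over the first one, which takes two
    more steps and overwrites register 0. *)
Lemma wp_if r c1 c2 Q f X inp out :
  0 < f ->
  (0 < X r -> wp c1 Q f.-1 X inp out) ->
  (X r = 0 -> wp c2 (fun f X inp out => 1 < f /\ Q (f - 2) (upd X 0 1) inp out)
                f.-1 X inp out) ->
  wp (If r c1 c2) Q f X inp out.
Proof.
move=> f0 H1 H2 P p /= cP.
have st := step_at X inp out cP.
have /= [_] := @code_at_cat _ _ [:: _] _ cP.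
move=> /code_at_cat [cP2]; rewrite size_compile.
move=> /(@code_at_cat _ _ [:: _; _]) /= [cPj cP1].
have /= cPj' := (@code_at_cat _ _ [:: _] [:: _] cPj).2.
have {}cP1 : code_at P (p + csize c2 + 3) (compile (p + csize c2 + 3) c1).
  by move: cP1; rewrite (_ : p + 1 + csize c2 + 2 = p + csize c2 + 3) //; lia.
case: (posnP (X r)) => Xr.
  rewrite addn1 in cP2 cPj cPj'.
  have [t [X' [inp' [out' [tf it [f2 q]]]]]] := H2 Xr _ _ cP2.
  exists (2 + (t + 1)), (upd X' 0 1), inp', out'; split; first by lia.
    rewrite !iterD /= st /= Xr it /=.
    rewrite (step_at _ _ _ cPj) /= -addn1 (step_at _ _ _ cPj') /=.
    by congr State; lia.
  by rewrite [f - _](_ : _ = f.-1 - t - 2) //; lia.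
have [t [X' [inp' [out' [tf it q]]]]] := H1 Xr _ _ cP1.
exists (t + 1), X', inp', out'; split; first by lia.
  by rewrite iterD /= st /= Xr it; congr State; lia.
by rewrite [f - _](_ : _ = f.-1 - t) //; lia.
Qed.

(** Termination comes from the time bound: each evaluation of the test takes one
    step, so the invariant [I] only has to guarantee that time is left. *)
Lemma wp_while r c (I Q : assertion) f X inp out :
  (forall f X inp out, I f X inp out ->
     [/\ 0 < f, 0 < X r -> wp c I f.-1 X inp out &
         X r = 0 -> Q f.-1 X inp out]) ->
  2 <= f -> I (f - 2) (upd X 0 1) inp out ->
  wp (While r c) Q f X inp out.
Proof.
move=> HI f2 I0 P p /= cP.
have st0 := step_at X inp out cP.
have [cPi] := @code_at_cat _ _ [:: _; _] _ cP.
move=> /code_at_cat /= [cPc]; rewrite size_compile => cPt.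
have cPj := (@code_at_cat _ _ [:: _] [:: _] cPi).2; rewrite /= addn1 in cPj.
have {}cPt : code_at P (p + csize c + 2) [:: IJumpPos (p + 2) r].
  by rewrite [p + _ + 2](_ : _ = p + 2 + csize c) //; lia.
have loop : forall g Y inp out, I g Y inp out ->
    exists t X' inp' out', [/\ t <= g,
      iter t (step P) (State (p + csize c + 2) Y inp out) =
      State (p + (csize c + 3)) X' inp' out' & Q (g - t) X' inp' out'].
  move=> g; have [m] := ubnP g; elim: m g => // m IH g gm Y inp1 out1 Ig.
  have [g0 H1 H0] := HI _ _ _ _ Ig; have st := step_at Y inp1 out1 cPt.
  case: (posnP (Y r)) => Yr.
    exists 1, Y, inp1, out1; rewrite /= st /= Yr subn1.
    split; [by lia| |exact: H0].
    by congr State; lia.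
  have [t [X' [inp' [out' [tg it q]]]]] := H1 Yr _ _ cPc.
  have [|t2 [X2 [inp2 [out2 [tg2 it2 q2]]]]] := IH (g.-1 - t) _ X' inp' out' q.
    by lia.
  exists (t2 + (t + 1)), X2, inp2, out2; split; first by lia.
    by rewrite !iterD /= st /= Yr it addnAC it2.
  by rewrite [g - _](_ : _ = g.-1 - t - t2) //; lia.
have [t [X' [inp' [out' [tg it q]]]]] := loop _ _ _ _ I0.
exists (t + 2), X', inp', out'; split; first by lia.
  by rewrite iterD /= st0 /= (step_at _ _ _ cPj) /= it.
by rewrite [f - _](_ : _ = f - 2 - t) //; lia.
Qed.

Lemma wp_computes c w f Q r :
  wp c Q f (fun=> 0) w [::] ->
  (forall f X inp out, Q f X inp out -> out = r) ->
  computes_within (compile 0 c) w f r.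
Proof.
move=> H Qr; have [|t [X [inp [out [tf it q]]]]] := H (compile 0 c) 0.
  by exists [::], [::]; rewrite cats0.
have halt m : iter m (step (compile 0 c)) (State (csize c) X inp out) =
              State (csize c) X inp out.
  elim: m => //= m ->; rewrite /step /=.
  suff -> : onth (compile 0 c) (csize c) = None by [].
  by rewrite -(size_compile 0); elim: (compile 0 c).
rewrite /computes_within /init -(subnK tf) iterD it add0n halt size_compile.
by split=> //; exact: Qr q.
Qed.

(** * Label propagation *)

Section LabelPropagation.

Variables (n : nat) (pr : nat -> seq nat) (i j : nat).
Hypotheses (i_lt : i < n) (j_lt : j < n) (ij : i != j).

(** The cuts of the graph whose nodes are the numbers below [n] and in which
    [pr v] lists the predecessors of [v]. *)
Definition nat_cut (L : nat -> bool) : Prop :=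
  [/\ L i, ~~ L j &
      forall u v, v < n -> u \in pr v -> u != i -> u != j -> L u = L v].

(** The state of a search: the label 0 marks unlabelled nodes, [q] lists the
    labelled ones in the order of their discovery, and [c] is positive as soon
    as a conflict has been met. [D] is the set of edges inspected so far. *)
Record labelling (D : nat -> nat -> Prop) (lab : nat -> nat) (q : seq nat)
    (c : nat) : Prop := Labelling {
  lab_uniq : uniq q;
  lab_lt : forall u, u \in q -> u < n;
  lab_mem : forall u, (u \in q) = (0 < lab u);
  lab_i : lab i = 1;
  lab_j : lab j = 2;
  lab_done : forall u v, D u v -> u != i -> u != j ->
    [/\ 0 < lab u, 0 < lab v & c = 0 -> lab u = lab v];
  lab_sound : forall L, nat_cut L ->
    c = 0 /\ forall u, 0 < lab u -> lab u = if L u then 1 else 2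
}.

Lemma labelling_weaken D D' lab q c :
  (forall u v, D' u v -> D u v) -> labelling D lab q c -> labelling D' lab q c.
Proof. by move=> DD [? ? ? ? ? done ?]; split=> // u v /DD; exact: done. Qed.

Definition add_edge (D : nat -> nat -> Prop) (u v a b : nat) : Prop :=
  D a b \/ (a = u /\ b = v).

Lemma labelling_init :
  labelling (fun _ _ => False) (upd (upd (fun=> 0) i 1) j 2) [:: i; j] 0.
Proof.
have ji : j == i = false by rewrite eq_sym; apply: negbTE.
split=> //.
- by rewrite /= inE ij.
- by move=> u; rewrite !inE => /orP [] /eqP ->.
- move=> u; rewrite !inE /upd; case: (eqVneq u j) => uj; first by rewrite orbT.
  by case: eqP.
- by rewrite /upd (negPf ij) eqxx.
- by rewrite /upd eqxx.
move=> L [Li /negPf Lj _]; split=> // u; rewrite /upd.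
case: eqP => [->|_]; first by rewrite Lj.
by case: eqP => [->|_] //; rewrite Li.
Qed.

Variables (D : nat -> nat -> Prop) (lab : nat -> nat) (q : seq nat) (c : nat).
Hypothesis inv : labelling D lab q c.

Lemma labelling_skip u v :
  (u == i) || (u == j) -> labelling (add_edge D u v) lab q c.
Proof.
case: inv => ? ? ? ? ? done ? uij; split=> // a b [|[-> _ ui uj]].
  exact: done.
by rewrite (negPf ui) (negPf uj) in uij.
Qed.

Lemma labelling_new u v :
  u != i -> u != j -> u < n -> v < n -> u \in pr v -> lab u = 0 -> 0 < lab v ->
  labelling (add_edge D u v) (upd lab u (lab v)) (rcons q u) c.
Proof.
case: inv => uq lt mem li lj done sound ui uj un vn uv lu lv.
have ne a : 0 < lab a -> (a == u) = false by case: eqP => // ->; rewrite lu.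
split=> //.
- by rewrite rcons_uniq uq mem lu.
- by move=> a; rewrite mem_rcons inE => /orP [/eqP ->|/lt].
- move=> a; rewrite mem_rcons inE mem /upd.
  by case: eqP => //= _; rewrite lv.
- by rewrite /upd ne ?li.
- by rewrite /upd ne ?lj.
- move=> a b [Dab ai aj|[-> ->] _ _].
    by have [la lb e] := done _ _ Dab ai aj; rewrite /upd !ne.
  by rewrite /upd eqxx ne.
move=> L cutL; have [c0 H] := sound L cutL; split=> // a.
rewrite /upd; case: eqP => [->|_]; last exact: H.
have [_ _ LE] := cutL; rewrite (LE u v) // => _; exact: H.
Qed.

Lemma labelling_old u v :
  u != i -> u != j -> v < n -> u \in pr v -> 0 < lab u -> 0 < lab v ->
  labelling (add_edge D u v) lab q (c + (lab u - lab v) + (lab v - lab u)).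
Proof.
case: inv => uq lt mem li lj done sound ui uj vn uv lu lv; split=> //.
  move=> a b [Dab ai aj|[-> ->] _ _].
    by have [la lb e] := done _ _ Dab ai aj; split=> //; lia.
  by split=> //; lia.
move=> L cutL; have [c0 H] := sound L cutL; split=> //.
have [_ _ LE] := cutL; rewrite H // [lab v]H // (LE u v) // subnn; lia.
Qed.

Definition edges_into (dn : seq nat) (u v : nat) : Prop :=
  v \in dn /\ u \in pr v.

(** [reach] is how strong connectivity is used: the set of labelled nodes
    contains [i] and [j] and, once all edges into it have been inspected, is
    closed under predecessors. *)
Lemma labelling_complete :
  (forall A : pred nat, A i -> A j ->
     (forall u v, v < n -> u \in pr v -> A v -> A u) ->
     forall u, u < n -> A u) ->
  (forall u v, v < n -> u \in pr v -> u < n) ->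
  (forall u v, edges_into q u v -> D u v) ->
  c = 0 <-> exists L, nat_cut L.
Proof.
move=> reach prn all_edges; case: inv => uq lt mem li lj done sound.
have all_lab u : u < n -> 0 < lab u.
  apply: (reach (fun u => 0 < lab u)); rewrite ?li ?lj // => {}u v vn uv lv.
  case: (eqVneq u i) => [->|ui]; first by rewrite li.
  case: (eqVneq u j) => [->|uj]; first by rewrite lj.
  by have [] // := done u v (all_edges u v _) ui uj; split; rewrite ?mem.
split=> [c0|[L /sound []] //].
exists (fun u => lab u == 1); split; rewrite ?li ?lj // => u v vn uv ui uj.
have [] := done u v (all_edges u v _) ui uj; last by move=> _ _ ->.
by split; rewrite ?mem ?all_lab.
Qed.

End LabelPropagation.

(** * The search program *)

Arguments upd : simpl never.

Lemma upd_eq X a x b : b == a -> upd X a x b = x.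
Proof. by rewrite /upd => ->. Qed.

Lemma upd_ne X a x b : b != a -> upd X a x b = X b.
Proof. by rewrite /upd => /negPf ->. Qed.

(* Evaluates register accesses, deciding with linear arithmetic whether two
   addresses are equal. *)
Ltac upds := repeat match goal with
  | |- context [upd ?X ?a ?x ?b] =>
      first [ rewrite (@upd_ne X a x b); [|solve [exact isT | lia]]
            | rewrite (@upd_eq X a x b); [|solve [exact isT | lia]] ]
  end.

(** Registers and memory, for a graph with [n] nodes:
    - 1, 2, 3, 4, 5 hold the constants [1], [n], [20], [20 + n], [20 + 2 n];
      6 holds 0 and is never written;
    - 7 and 8 hold the pair [i], [j] under test; 12 and 13 count the rows and
      the entries that remain to be written;
    - 9 counts conflicts; 10 and 11 hold the addresses of the first
      unprocessed entry of the queue and of its end;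
    - 14 holds the label of the node being processed, 15 an address, 16 a loop
      counter, 17 a predecessor; 18 and 19 are temporaries;
    - [20 + u] holds the label of [u], [20 + n + k] the entry [k] of the queue,
      [20 + 2 n + v] the address of the list of [v]; the lists, each preceded
      by its length, are stored from [20 + 3 n] on.

    Distinctness of two numbers is tested by adding their two truncated
    differences. *)
Definition inspect_pred : cmd :=
  Seq (Block [:: IAdd 15 15 1; IFetch 17 15; ISub 16 16 1; ISub 18 17 7;
                 ISub 19 7 17; IAdd 18 18 19])
  (If 18
    (Seq (Block [:: ISub 18 17 8; ISub 19 8 17; IAdd 18 18 19])
    (If 18
      (Seq (Block [:: IAdd 18 3 17; IFetch 19 18])
      (If 19
        (Block [:: ISub 18 19 14; ISub 19 14 19; IAdd 9 9 18; IAdd 9 9 19])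
        (Block [:: IStore 18 14; IStore 11 17; IAdd 11 11 1])))
      (Block [::])))
    (Block [::])).

Definition scan_preds : cmd :=
  Seq (Block [:: IFetch 17 10; IAdd 10 10 1; IAdd 15 3 17; IFetch 14 15;
                 IAdd 15 5 17; IFetch 15 15; IFetch 16 15])
  (Seq (While 16 inspect_pred) (Block [:: ISub 18 11 10])).

Definition clear_labels : cmd :=
  Seq (Block [:: IAdd 15 3 6; IAdd 16 2 6])
  (While 16 (Block [:: IStore 15 6; IAdd 15 15 1; ISub 16 16 1])).

Definition search : cmd :=
  Seq clear_labels
  (Seq (Block [:: IConst 9 0; IAdd 15 3 7; IStore 15 1; IAdd 15 3 8;
                  IConst 18 2; IStore 15 18; IStore 4 7; IAdd 15 4 1;
                  IStore 15 8; IAdd 10 4 6; IAdd 11 15 1; ISub 18 11 10])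
  (While 18 scan_preds)).

Definition stored (n : nat) (X : nat -> nat) (v : nat) (s : seq nat) : Prop :=
  let a := X (20 + 2 * n + v) in
  [/\ 20 + 3 * n <= a, X a = size s &
      forall k, k < size s -> X (a + k.+1) = nth 0 s k].

(** * Correctness and cost of a search *)

Section SearchCorrect.

Variables (n : nat) (pr : nat -> seq nat) (i j : nat).
Hypotheses (i_lt : i < n) (j_lt : j < n) (ij : i != j).
Hypothesis prn : forall u v, v < n -> u \in pr v -> u < n.
Hypothesis reach : forall A : pred nat, A i -> A j ->
     (forall u v, v < n -> u \in pr v -> A v -> A u) ->
     forall u, u < n -> A u.

Variable X0 : nat -> nat.
Hypotheses (X1 : X0 1 = 1) (X2 : X0 2 = n) (X3 : X0 3 = 20)
  (X4 : X0 4 = 20 + n) (X5 : X0 5 = 20 + 2 * n) (X6 : X0 6 = 0)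
  (X7 : X0 7 = i) (X8 : X0 8 = j).
Hypothesis X_stored : forall v, v < n -> stored n X0 v (pr v).

(** The addresses that a search may overwrite. *)
Definition scratch (a : nat) : bool :=
  [|| a == 0, 9 <= a <= 11 | 14 <= a < 20 + 2 * n].

Definition keeps (X : nat -> nat) : Prop :=
  forall a, ~~ scratch a -> X a = X0 a.

Lemma keeps_upd X a x : scratch a -> keeps X -> keeps (upd X a x).
Proof.
move=> sa kX b sb; rewrite upd_ne ?kX //.
by apply: contraNneq sb => ->.
Qed.

Lemma keeps_regs X : keeps X ->
  [/\ X 1 = 1, X 2 = n, X 3 = 20, X 4 = 20 + n &
      [/\ X 5 = 20 + 2 * n, X 6 = 0, X 7 = i & X 8 = j]].
Proof. by move=> kX; rewrite !kX. Qed.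

(** [h] is the number of entries of the queue [q] already processed. *)
Definition represents (X : nat -> nat) lab (q : seq nat) c h : Prop :=
  [/\ X 9 = c, X 10 = 20 + n + h, X 11 = 20 + n + size q,
      forall u, u < n -> X (20 + u) = lab u &
      forall k, k < size q -> X (20 + n + k) = nth 0 q k].

Lemma represents_upd X lab q c h a x :
  a = 0 \/ 14 <= a < 20 ->
  represents X lab q c h -> represents (upd X a x) lab q c h.
Proof.
move=> aP [r9 r10 r11 rl rq]; split; first [move=> k kn; upds | upds] => //.
  exact: rl.
exact: rq.
Qed.

Lemma labelling_size D lab q c : labelling n pr i j D lab q c -> size q <= n.
Proof.
case=> uq lt _ _ _ _ _; rewrite -(size_iota 0 n).
by apply: uniq_leq_size => // u /lt; rewrite mem_iota.
Qed.

(** In this and the following lemmas, [G] is the time left to the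
    continuation. *)
Lemma inspect_pred_wp (Q : assertion) G f X inp out D lab q c h v u a d :
  labelling n pr i j D lab q c -> keeps X -> represents X lab q c h ->
  v < n -> u \in pr v -> 0 < lab v ->
  X 14 = lab v -> X 15 = a -> 20 <= a -> X 16 = d -> X a.+1 = u ->
  G + 19 <= f ->
  (forall f' X' lab' q' c', G <= f' ->
     labelling n pr i j (add_edge D u v) lab' q' c' ->
     keeps X' -> represents X' lab' q' c' h -> lab' v = lab v ->
     (exists s, q' = q ++ s) ->
     X' 14 = lab v -> X' 15 = a.+1 -> X' 16 = d.-1 -> Q f' X' inp out) ->
  wp inspect_pred Q f X inp out.
Proof.
move=> inv kX repr vn uv lv x14 x15 a20 x16 xu Gf HQ.
have un := prn vn uv.
have [x1 x2 x3 x4 [x5 x6 x7 x8]] := keeps_regs kX.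
have [r9 r10 r11 rl rq] := repr.
have sq := labelling_size inv.
apply: wp_seq; apply: wp_block => //=; first by lia.
upds; rewrite x1 x15 x16 x7 addn1; upds; rewrite xu subn1.
set Y := upd _ 18 _.
have kY : keeps Y by rewrite /Y; do 6 (apply: keeps_upd => //).
have rY : represents Y lab q c h.
  by rewrite /Y; do 6 (apply: represents_upd; first by lia).
have [y15 y16 y17 y14] : [/\ Y 15 = a.+1, Y 16 = d.-1, Y 17 = u & Y 14 = lab v].
  by rewrite /Y; upds.
have y18 : Y 18 = (u - i) + (i - u) by rewrite /Y; upds.
clearbody Y.
have skip f' : G <= f' -> (u == i) || (u == j) -> Q f' (upd Y 0 1) inp out.
  move=> Gf' uij; apply: (HQ _ _ lab q c) => //.
  - exact: labelling_skip.
  - exact: keeps_upd.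
  - by exists [::]; rewrite cats0.
apply: wp_if; first by lia.
  rewrite y18 => ui; have {ui} ui : u != i by lia.
  have [z1 z2 z3 z4 [z5 z6 z7 z8]] := keeps_regs kY.
  apply: wp_seq; apply: wp_block => //=; first by lia.
  upds; rewrite z8 y17.
  have kZ : keeps
      (upd (upd (upd Y 18 (u - j)) 19 (j - u)) 18 (u - j + (j - u))).
    by do 3 (apply: keeps_upd => //).
  have rZ : represents
      (upd (upd (upd Y 18 (u - j)) 19 (j - u)) 18 (u - j + (j - u))) lab q c h.
    by do 3 (apply: represents_upd; first by lia).
  apply: wp_if; first by lia.
    upds => uj; have {uj} uj : u != j by lia.
    apply: wp_seq; apply: wp_block => //=; first by lia.
    have [_ _ _ slab _] := rY.
    upds; rewrite z3 y17; upds; rewrite slab //.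
    move: kZ rZ; set Z := upd _ 18 _ => kZ rZ.
    set W := upd (upd Z 18 _) 19 _.
    have kW : keeps W by do 2 (apply: keeps_upd => //).
    have rW : represents W lab q c h.
      by do 2 (apply: represents_upd; first by lia).
    have [w14 w15 w16 w17] :
        [/\ W 14 = lab v, W 15 = a.+1, W 16 = d.-1 & W 17 = u].
      by rewrite /W /Z; upds.
    have [w18 w19] : W 18 = 20 + u /\ W 19 = lab u by rewrite /W; upds.
    clearbody W; move: rW => [r9' r10' r11' rl' rq'].
    apply: wp_if; first by lia.
      rewrite w19 => lu; apply: wp_block => //=; first by lia.
      upds; rewrite w19 w14 r9'.
      apply: (HQ _ _ lab q (c + (lab u - lab v) + (lab v - lab u))).
      - by lia.
      - exact: labelling_old.
      - by do 4 (apply: keeps_upd => //).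
      - split; first [move=> k kn; upds | upds] => //; [exact: rl'|exact: rq'].
      - by [].
      - by exists [::]; rewrite cats0.
      - by upds.
      - by upds.
      - by upds.
    rewrite w19 => lu; apply: wp_block => //=; first by lia.
    split; first by lia.
    have inv' := labelling_new inv ui uj un vn uv lu lv.
    have := labelling_size inv'; rewrite size_rcons => sq'.
    have [w1 _ _ _ _] := keeps_regs kW.
    upds; rewrite w14 w17 w18 r11' w1 addn1.
    apply: (HQ _ _ _ _ _ _ inv'); first by lia.
    - apply: keeps_upd => //; apply: keeps_upd; last apply: keeps_upd;
        last apply: keeps_upd => //; rewrite /scratch; lia.
    - split; rewrite ?size_rcons; first [move=> k kn | idtac].
      + by upds.
      + by upds.
      + by upds; lia.
      + upds; case: (eqVneq k u) => ku.
          by rewrite ku; upds.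
        by rewrite upd_ne ?[upd lab _ _ _]upd_ne ?rl'; lia.
      + rewrite nth_rcons; case: ltnP => kq.
          by upds; exact: rq'.
        have -> : k = size q by lia.
        by rewrite eqxx; upds.
    - by rewrite upd_ne //; apply: contraTneq lv => ->; rewrite lu.
    - by exists [:: u]; rewrite cats1.
    - by upds.
    - by upds.
    - by upds.
  upds => uj; apply: wp_block => //=.
  split; first by lia.
  apply: (HQ _ _ lab q c) => //.
  - by lia.
  - by apply: labelling_skip => //; lia.
  - exact: keeps_upd.
  - by exists [::]; rewrite cats0.
move=> ui; apply: wp_block => //=.
split; first by lia.
by apply: skip; lia.
Qed.

(** The queue is split into the processed nodes [dn], the node [v] to be
    processed and the waiting nodes [td]. *)
Lemma scan_preds_wp (Q : assertion) G f X inp out dn v td lab c :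
  labelling n pr i j (edges_into pr dn) lab (dn ++ v :: td) c ->
  keeps X -> represents X lab (dn ++ v :: td) c (size dn) ->
  G + 20 * size (pr v) + 12 <= f ->
  (forall f' X' lab' td' c', G <= f' ->
     labelling n pr i j (edges_into pr (rcons dn v))
       lab' (rcons dn v ++ td') c' ->
     keeps X' ->
     represents X' lab' (rcons dn v ++ td') c' (size (rcons dn v)) ->
     X' 18 = size td' -> Q f' X' inp out) ->
  wp scan_preds Q f X inp out.
Proof.
move=> inv kX repr Gf HQ.
have [x1 x2 x3 x4 [x5 x6 x7 x8]] := keeps_regs kX.
have [r9 r10 r11 rl rq] := repr.
have vq : v \in dn ++ v :: td by rewrite mem_cat inE eqxx orbT.
have vn : v < n := lab_lt inv vq.
have lv : 0 < lab v by rewrite -(lab_mem inv).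
have [] := X_stored vn; set a := X0 _ => an Xa Xs.
have ns b : 20 + 2 * n <= b -> ~~ scratch b by rewrite /scratch; lia.
have xv : X (20 + n + size dn) = v.
  by rewrite rq ?nth_cat ?ltnn ?subnn // size_cat /=; lia.
have xp : X (20 + 2 * n + v) = a by rewrite kX // ns //; lia.
have xa : X a = size (pr v) by rewrite kX // ns //; lia.
apply: wp_seq; apply: wp_block => //=; first by lia.
upds; rewrite r10 xv x1 x3 x5 addn1; upds; rewrite rl // xp; upds; rewrite xa.
set Y := upd _ 16 _.
have kY : keeps Y by rewrite /Y; do 7 (apply: keeps_upd => //).
have rY : represents Y lab (dn ++ v :: td) c (size dn).+1.
  rewrite /Y; do 5 (apply: represents_upd; first by lia).
  split; first [move=> k kn; upds | upds] => //; try lia.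
    exact: rl.
  exact: rq.
have [y14 y15 y16] : [/\ Y 14 = lab v, Y 15 = a & Y 16 = size (pr v)].
  by rewrite /Y; upds.
clearbody Y.
apply: wp_seq.
pose I : assertion := fun f' X' inp' out' => exists k lab' td' c',
  [/\ k <= size (pr v),
      labelling n pr i j (fun u w => edges_into pr dn u w \/
                            (u \in take k (pr v) /\ w = v))
        lab' (dn ++ v :: td') c',
      keeps X', represents X' lab' (dn ++ v :: td') c' (size dn).+1 &
      [/\ X' 14 = lab' v, X' 15 = a + k, X' 16 = size (pr v) - k,
          inp' = inp /\ out' = out & G + 20 * (size (pr v) - k) + 2 <= f']].
apply: (@wp_while _ _ I); last 2 first.
- by lia.
- exists 0, lab, td, c; split=> //.
  + by apply: labelling_weaken inv => u w [] // []; rewrite take0.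
  + exact: keeps_upd.
  + by split=> //; upds; lia.
move=> f1 Z inp1 out1 [k [lab' [td' [c' [kp inv' kX' repr']]]]].
move=> [e14 e15 e16 [-> ->] Gf'].
split; first by lia.
  move=> d0; have {d0 kp} kp : k < size (pr v) by lia.
  have lv' : 0 < lab' v.
    by rewrite -(lab_mem inv') mem_cat inE eqxx orbT.
  have nthk : nth 0 (pr v) k \in pr v by rewrite mem_nth.
  apply: (@inspect_pred_wp I (G + 20 * (size (pr v) - k.+1) + 2) _ _ _ _ _ _ _ _
           _ _ _ _ _ inv' kX' repr' vn nthk lv' e14 e15 _ e16).
  - by lia.
  - by rewrite -addnS kX' ?Xs // ns //; lia.
  - by lia.
  move=> f' X' lab2 q2 c2 Gf2 inv2 kX2 repr2 l2 [s q2E] e14' e15' e16'.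
  exists k.+1, lab2, (td' ++ s), c2; rewrite -cat_cons catA -q2E; split=> //.
    apply: labelling_weaken inv2 => b w [|[]]; first by left; left.
    rewrite (take_nth 0) // mem_rcons inE => /orP [/eqP -> ->|bk ->].
      by right.
    by left; right.
  by split=> //; rewrite ?e14' ?e15' ?e16' //; lia.
move=> d0; have {d0 kp} kp : k = size (pr v) by lia.
apply: wp_block => //=; first by lia.
have [r9' r10' r11' rl' rq'] := repr'.
have repr2 :
    represents (upd Z 18 (Z 11 - Z 10)) lab' (dn ++ v :: td') c' (size dn).+1.
  by apply: represents_upd => //; lia.
apply: (HQ _ _ lab' td' c'); rewrite ?cat_rcons ?size_rcons //.
- by lia.
- apply: labelling_weaken inv' => b w []; rewrite mem_rcons inE.
  by move=> /orP [/eqP ->|wdn] bw; [right; rewrite kp take_size|left].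
- exact: keeps_upd.
- by upds; rewrite r10' r11' size_cat /=; lia.
Qed.

(** The time that processing the nodes outside [dn] can still take. Since a node
    enters the queue at most once, this bounds the rest of the search. *)
Definition potential (dn : seq nat) : nat :=
  \sum_(v < n | val v \notin dn) (20 * size (pr v) + 13).

Lemma potential_rcons dn v :
  v < n -> v \notin dn ->
  potential dn = 20 * size (pr v) + 13 + potential (rcons dn v).
Proof.
move=> vn vdn; rewrite /potential (bigD1 (Ordinal vn)) //=; congr (_ + _).
by apply: eq_bigl => u; rewrite mem_rcons inE negb_or andbC.
Qed.

Lemma clear_labels_wp (Q : assertion) G f X inp out :
  keeps X -> G + 4 * n + 5 <= f ->
  (forall f' X', G <= f' -> keeps X' -> (forall u, u < n -> X' (20 + u) = 0) ->
     Q f' X' inp out) ->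
  wp clear_labels Q f X inp out.
Proof.
move=> kX Gf HQ; have [x1 x2 x3 x4 [x5 x6 x7 x8]] := keeps_regs kX.
apply: wp_seq; apply: wp_block => //=; first by lia.
upds; rewrite x2 x3 x6 !addn0.
pose I : assertion := fun f' X' inp' out' => exists k,
  [/\ k <= n, keeps X', forall u, u < k -> X' (20 + u) = 0,
      X' 15 = 20 + k & [/\ X' 16 = n - k, inp' = inp, out' = out &
                           G + 4 * (n - k) + 1 <= f']].
apply: (@wp_while _ _ I); last 2 first.
- by lia.
- exists 0; split=> //; last by split=> //; upds; lia.
  by do 3 (apply: keeps_upd => //).
move=> f1 Z inp1 out1 [k [kn {}kX Xk e15 [e16 -> -> Gf']]].
have [{}x1 {}x2 {}x3 {}x4 [{}x5 {}x6 {}x7 {}x8]] := keeps_regs kX.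
split; first by lia.
  move=> k0; have {k0} k0 : k < n by lia.
  apply: wp_block => //=; first by lia.
  upds; rewrite e15 e16 x1 x6.
  exists k.+1; split=> //; last by split=> //; upds; lia.
  + do 2 (apply: keeps_upd => //); apply: keeps_upd => //.
    by rewrite /scratch; lia.
  + move=> u uk; upds; case: (eqVneq u k) => [->|ku]; first by upds.
    by upds; apply: Xk; lia.
  + by upds; lia.
move=> k0; apply: HQ => //; first by lia.
by move=> u un; apply: Xk; lia.
Qed.

Lemma search_wp (Q : assertion) G f inp out :
  G + potential [::] + 4 * n + 20 <= f ->
  (forall f' X', G <= f' -> keeps X' ->
     (X' 9 = 0 <-> exists L, nat_cut n pr i j L) -> Q f' X' inp out) ->
  wp search Q f X0 inp out.
Proof.
move=> Gf HQ; apply: wp_seq.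
apply: (@clear_labels_wp _ (G + potential [::] + 15)) => //; first by lia.
move=> {Gf}f' X Gf kX X_clear.
have [x1 x2 x3 x4 [x5 x6 x7 x8]] := keeps_regs kX.
apply: wp_seq; apply: wp_block => //=; first by lia.
upds; rewrite x1 x3 x4 x6 x7 x8 !addn0 addn1; upds; rewrite !addn1.
set Y := upd _ 18 _.
have kY : keeps Y.
  rewrite /Y.
  by repeat (apply: keeps_upd; first by rewrite // /scratch; lia).
have inv0 := labelling_init pr i_lt j_lt ij.
have rY : represents Y (upd (upd (fun=> 0) i 1) j 2) [:: i; j] 0 0.
  rewrite /Y; split; first [move=> k kn | idtac]; rewrite /=.
  - by upds.
  - by upds; rewrite addn0.
  - by upds; lia.
  - upds; case: (eqVneq k j) => [->|kj]; first by upds.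
    case: (eqVneq k i) => [->|ki]; first by upds.
    by upds; rewrite X_clear.
  - case: k kn => [|[|]] //= _; first by rewrite addn0; upds.
    by upds.
have y18 : Y 18 = 2 by rewrite /Y; upds; lia.
clearbody Y.
pose I : assertion := fun f' X' inp' out' => exists dn td lab c,
  [/\ labelling n pr i j (edges_into pr dn) lab (dn ++ td) c, keeps X',
      represents X' lab (dn ++ td) c (size dn), X' 18 = size td &
      [/\ inp' = inp, out' = out & G + potential dn + 1 <= f']].
apply: (@wp_while _ _ I); last 2 first.
- by lia.
- exists [::], [:: i; j], (upd (upd (fun=> 0) i 1) j 2), 0; split=> //.
  + by apply: labelling_weaken inv0 => u v [].
  + exact: keeps_upd.
  + by split=> //; lia.
move=> f1 Z inp1 out1 [dn [td [lab [c [inv kX' repr e]]]]] [-> -> Gf'].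
split; first by lia.
  rewrite e; case: td inv repr e => // v td inv repr e _.
  have vq : v \in dn ++ v :: td by rewrite mem_cat inE eqxx orbT.
  have vn : v < n := lab_lt inv vq.
  have vdn : v \notin dn.
    have := lab_uniq inv; rewrite cat_uniq => /and3P [_ /hasPn h _].
    by apply: h; rewrite inE eqxx.
  rewrite (potential_rcons vn vdn) in Gf'.
  apply: (@scan_preds_wp I (G + potential (rcons dn v) + 1) _ _ _ _ _ _ _ _ _
            inv kX' repr).
    by move: Gf'; set p := potential (rcons dn v); lia.
  move=> f2 Z2 lab' td' c' Gf2 inv2 kZ2 repr2 e2.
  by exists (rcons dn v), td', lab', c'.
rewrite e => /size0nil td0; rewrite {td}td0 cats0 in inv repr e.
apply: HQ; rewrite //; first by lia.
have [-> _ _ _ _] := repr.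
exact: (labelling_complete inv reach prn).
Qed.

End SearchCorrect.

(** * Reading the graph *)

Definition read_list : cmd :=
  While 16 (Block [:: IRead 17; IStore 7 17; IAdd 7 7 1; ISub 16 16 1]).

(** While reading, registers 7 and 8 are the next free addresses of the list
    area and of the address table, and 12 counts the lists to come. *)
Definition read_graph : cmd :=
  Seq (Block [:: IConst 1 1; IRead 2; IConst 3 20; IAdd 4 3 2; IAdd 5 4 2;
                 IAdd 7 5 2; IAdd 8 5 6; IAdd 12 2 6])
  (While 12
    (Seq (Block [:: IStore 8 7; IRead 16; IStore 7 16; IAdd 7 7 1;
                    IAdd 8 8 1; ISub 12 12 1])
         read_list)).

Lemma read_list_wp (Q : assertion) G f X s inp out cur :
  X 1 = 1 -> X 7 = cur -> 20 <= cur -> X 16 = size s ->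
  G + 5 * size s + 3 <= f ->
  (forall f' X', G <= f' ->
     (forall a, ~~ [|| a == 0, a == 7, a == 16 | a == 17] ->
        ~~ (cur <= a < cur + size s) -> X' a = X a) ->
     (forall k, k < size s -> X' (cur + k) = nth 0 s k) ->
     X' 7 = cur + size s -> Q f' X' inp out) ->
  wp read_list Q f X (s ++ inp) out.
Proof.
move=> x1 x7 cur20 x16 Gf HQ.
pose I : assertion := fun f' X' inp' out' => exists2 k, k <= size s &
  [/\ forall a, ~~ [|| a == 0, a == 7, a == 16 | a == 17] ->
        ~~ (cur <= a < cur + size s) -> X' a = X a,
      forall m, m < k -> X' (cur + m) = nth 0 s m,
      X' 7 = cur + k, X' 16 = size s - k &
      [/\ inp' = drop k s ++ inp, out' = out &
          G + 5 * (size s - k) + 1 <= f']].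
apply: (@wp_while _ _ I); last 2 first.
- by lia.
- exists 0 => //; split=> //; [|by upds; lia|by upds; lia|].
    move=> a a1 a2; upds; by [].
  by rewrite drop0; split=> //; lia.
move=> f1 Z inp1 out1 [k ks [Za Zs z7 z16 [-> -> Gf1]]].
split; first by lia.
  move=> k0; have {}ks : k < size s by lia.
  have z1 : Z 1 = 1 by rewrite Za //; lia.
  apply: wp_block => //=; first by lia.
  rewrite (drop_nth 0) //=.
  upds; rewrite z1 z7 z16; exists k.+1 => //; split.
  - by move=> a a1 a2; upds; rewrite Za.
  - move=> m mk; upds; case: (eqVneq m k) => [->|mk']; first by upds.
    by upds; rewrite Zs //; lia.
  - by upds; lia.
  - by upds; lia.
  - by split=> //; lia.
move=> k0; have kE : k = size s by lia.
rewrite kE drop_size; apply: HQ => //; first by lia.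
  by move=> m ms; apply: Zs; lia.
by rewrite z7 kE.
Qed.

(** The part of the memory that reading establishes and that writing the matrix
    leaves unchanged. *)
Definition env (n : nat) (pr : nat -> seq nat) (X : nat -> nat) : Prop :=
  [/\ X 1 = 1, X 2 = n, X 3 = 20, X 4 = 20 + n &
      [/\ X 5 = 20 + 2 * n, X 6 = 0 &
          forall v, v < n -> stored n X v (pr v)]].

Lemma env_upd n pr X a x :
  a = 0 \/ 7 <= a < 20 -> env n pr X -> env n pr (upd X a x).
Proof.
move=> aP [e1 e2 e3 e4 [e5 e6 es]].
split; [| | | |split]; try by upds.
move=> v vn; have [an sz el] := es v vn.
have xv : upd X a x (20 + 2 * n + v) = X (20 + 2 * n + v) by upds.
rewrite /stored xv; split=> //; first by upds.
by move=> k kn; upds; exact: el.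
Qed.

Lemma env_keeps n pr X X' : env n pr X -> keeps n X X' -> env n pr X'.
Proof.
move=> [e1 e2 e3 e4 [e5 e6 es]] kX.
split; [| | | |split]; try by rewrite kX.
move=> v vn; have [an sz el] := es v vn.
have ns b : 20 + 2 * n <= b -> X' b = X b.
  by move=> nb; apply: kX; rewrite /scratch; lia.
have xv : X' (20 + 2 * n + v) = X (20 + 2 * n + v) by apply: ns; lia.
rewrite /stored xv; split=> //; first by rewrite ns //; lia.
by move=> k kn; rewrite ns ?el //; lia.
Qed.

Definition encode_lists (gs : seq (seq nat)) : seq nat :=
  flatten [seq size s :: s | s <- gs].

Lemma read_graph_wp (Q : assertion) G f gs :
  G + 5 * sumn (map size gs) + 10 * size gs + 11 <= f ->
  (forall f' X', G <= f' -> env (size gs) (nth [::] gs) X' ->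
     Q f' X' [::] [::]) ->
  wp read_graph Q f (fun=> 0) (size gs :: encode_lists gs) [::].
Proof.
move=> Gf HQ; set n := size gs.
apply: wp_seq; apply: wp_block => //=; first by lia.
upds; rewrite addn0.
pose I : assertion := fun f' X' inp' out' => exists2 k, k <= n &
  [/\ [/\ X' 1 = 1, X' 2 = n, X' 3 = 20, X' 4 = 20 + n &
          [/\ X' 5 = 20 + 2 * n, X' 6 = 0, X' 12 = n - k &
              X' 8 = 20 + 2 * n + k]],
      20 + 3 * n <= X' 7,
      (forall v, v < k -> stored n X' v (nth [::] gs v) /\
          X' (20 + 2 * n + v) + size (nth [::] gs v) < X' 7) &
      [/\ inp' = encode_lists (drop k gs), out' = [::] &
          G + 5 * sumn (map size (drop k gs)) + 10 * (n - k) + 1 <= f']].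
apply: (@wp_while _ _ I); last 2 first.
- by lia.
- exists 0 => //; split=> //.
  + by split; [| | | |split]; upds; lia.
  + by upds; lia.
  + by rewrite drop0; split=> //; lia.
move=> f1 Z inp1 out1 [k kn [[z1 z2 z3 z4 [z5 z6 z12 z8]] z7 Zs [-> -> Gf1]]].
split; first by lia.
  move=> k0; have {}kn : k < n by lia.
  rewrite (drop_nth [::]) //= in Gf1.
  apply: wp_seq; apply: wp_block => //=; first by lia.
  rewrite (drop_nth [::]) //= /encode_lists /= -/(encode_lists _).
  set s := nth [::] gs k in Gf1 *.
  upds; rewrite z1 z8 z12; upds; rewrite !addn1.
  set Y := upd _ 12 _.
  apply: (@read_list_wp _ (G + 5 * sumn (map size (drop k.+1 gs))
            + 10 * (n - k.+1) + 1) _ _ _ _ _ (Z 7).+1).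
  - by rewrite /Y; upds.
  - by rewrite /Y; upds.
  - by lia.
  - by rewrite /Y; upds.
  - by lia.
  move=> f2 W Gf2 Wa Ws w7.
  have Wlow a : 7 < a < 16 \/ 0 < a < 7 \/ 17 < a <= Z 7 -> W a = Y a.
    by move=> aP; apply: Wa; lia.
  exists k.+1 => //; split.
  - split; [| | | |split]; rewrite Wlow ?/Y; try lia; upds; lia.
  - by lia.
  - move=> v vk; case: (eqVneq v k) => [->|vk'].
      have wv : W (20 + 2 * n + k) = Z 7.
        by rewrite Wlow /Y; [upds|lia].
      rewrite /stored wv -/s; split; last by lia.
      split; [by lia | by rewrite Wlow /Y; [upds|lia] |].
      by move=> m ms; rewrite -Ws //; congr W; lia.
    have [[an sz el] lt7] := Zs v ltac:(lia).
    have Wold a : 20 <= a < Z 7 -> a <> 20 + 2 * n + k -> W a = Z a.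
      by move=> a1 a2; rewrite Wlow /Y; [upds|lia].
    have wv : W (20 + 2 * n + v) = Z (20 + 2 * n + v) by apply: Wold; lia.
    rewrite /stored wv; split; last by lia.
    split; [by lia | by rewrite Wold //; lia |].
    by move=> m ms; rewrite Wold ?el //; lia.
  - by split.
move=> k0; have kE : k = n by lia.
rewrite kE drop_size; apply: HQ; first by lia.
split=> //; split=> // v vn.
by have [] := Zs v ltac:(lia).
Qed.

(** * Writing the adjacency matrix *)

(** Register 9 starts at 1, so that the entry is 0 on the diagonal, where no
    search is run; [1 - X_9] is 1 exactly when a search met no conflict. *)
Definition write_entry : cmd :=
  Seq (Block [:: ISub 18 7 8; ISub 19 8 7; IAdd 18 18 19; IConst 9 1])
  (Seq (If 18 search (Block [::]))
  (Block [:: ISub 9 1 9; IWrite 9; IAdd 8 8 1; ISub 13 13 1])).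

Definition write_row : cmd :=
  Seq (Block [:: IConst 8 0; IAdd 13 2 6])
  (Seq (While 13 write_entry)
  (Block [:: IAdd 7 7 1; ISub 12 12 1])).

Definition write_matrix : cmd :=
  Seq (Block [:: IConst 7 0; IAdd 12 2 6]) (While 12 write_row).

Section Matrix.

Variables (n : nat) (pr : nat -> seq nat) (res : nat -> nat -> bool).
Hypothesis prn : forall u v, v < n -> u \in pr v -> u < n.
Hypothesis reach : forall A : pred nat, forall i, i < n -> A i ->
     (forall u v, v < n -> u \in pr v -> A v -> A u) ->
     forall u, u < n -> A u.
Hypothesis res_cut : forall i j, i < n -> j < n ->
  res i j <-> i != j /\ exists L, nat_cut n pr i j L.

Definition entry_cost := potential n pr [::] + 4 * n + 40.

Lemma write_entry_wp (Q : assertion) G f X inp (out : seq nat) i j a b :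
  env n pr X -> X 7 = i -> X 8 = j -> X 12 = a -> X 13 = b -> i < n -> j < n ->
  G + entry_cost <= f ->
  (forall f' X', G <= f' -> env n pr X' -> X' 7 = i -> X' 8 = j.+1 ->
     X' 12 = a -> X' 13 = b.-1 ->
     Q f' X' inp (rcons out (nat_of_bool (res i j)))) ->
  wp write_entry Q f X inp out.
Proof.
rewrite /entry_cost => eX x7 x8 x12 x13 i_lt j_lt Gf HQ.
apply: wp_seq; apply: wp_block => //=; first by lia.
upds; rewrite x7 x8; set Y := upd _ 9 1.
have eY : env n pr Y by rewrite /Y; do 4 (apply: env_upd; first by lia).
have [y7 y8 y12 y13] : [/\ Y 7 = i, Y 8 = j, Y 12 = a & Y 13 = b].
  by rewrite /Y; upds.
have [y9 y18] : Y 9 = 1 /\ Y 18 = (i - j) + (j - i) by rewrite /Y; upds.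
clearbody Y; apply: wp_seq.
have finish f' Z : G + 4 <= f' -> env n pr Z -> Z 7 = i -> Z 8 = j ->
    Z 12 = a -> Z 13 = b -> (1 - Z 9 = nat_of_bool (res i j)) ->
    wp (Block [:: ISub 9 1 9; IWrite 9; IAdd 8 8 1; ISub 13 13 1])
      Q f' Z inp out.
  move=> Gf' eZ z7 z8 z12 z13 z9; have [z1 _ _ _ _] := eZ.
  apply: wp_block => //=; first by lia.
  upds; rewrite z1 z9; apply: HQ; first by lia.
  - by do 3 (apply: env_upd; first by lia).
  - by upds.
  - by upds; lia.
  - by upds.
  - by upds; lia.
apply: wp_if; first by lia.
  rewrite y18 => ij; have {}ij : i != j by lia.
  have [y1 y2 y3 y4 [y5 y6 ys]] := eY.
  apply: (@search_wp n pr i j i_lt j_lt ij prn _ Y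
            y1 y2 y3 y4 y5 y6 y7 y8 ys _ (G + 4)).
  - by move=> A Ai _; exact: (reach i_lt Ai).
  - by lia.
  move=> f' Z Gf' kZ zc; apply: finish => //.
  - exact: env_keeps eY kZ.
  - by rewrite kZ.
  - by rewrite kZ.
  - by rewrite kZ.
  - by rewrite kZ.
  case: (boolP (res i j)) => [/res_cut [] // _ /zc -> //|nres].
  case: (posnP (Z 9)) => [/zc cutL|]; last by case: (Z 9).
  by case/negP: nres; apply/res_cut.
move=> ij; apply: wp_block => //=; split; first by lia.
apply: finish; try (by upds); first by lia.
  by apply: env_upd => //; lia.
upds; rewrite y9; case: (boolP (res i j)) => // /res_cut [] // ij'.
by lia.
Qed.

Lemma write_row_wp (Q : assertion) G f X inp (out : seq nat) i a :
  env n pr X -> X 7 = i -> X 12 = a -> i < n ->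
  G + n * (entry_cost + 1) + 10 <= f ->
  (forall f' X', G <= f' -> env n pr X' -> X' 7 = i.+1 -> X' 12 = a.-1 ->
     Q f' X' inp (out ++ [seq nat_of_bool (res i j) | j <- iota 0 n])) ->
  wp write_row Q f X inp out.
Proof.
move=> eX x7 x12 i_lt Gf HQ; have [x1 x2 _ _ [_ x6 _]] := eX.
apply: wp_seq; apply: wp_block => //=; first by nia.
upds; rewrite x2 x6 addn0; apply: wp_seq.
pose I : assertion := fun f' X' inp' out' => exists2 k, k <= n &
  [/\ env n pr X', X' 7 = i, X' 8 = k, X' 12 = a &
      [/\ X' 13 = n - k, inp' = inp,
          out' = out ++ [seq nat_of_bool (res i j) | j <- iota 0 k] &
          G + (n - k) * (entry_cost + 1) + 3 <= f']].
apply: (@wp_while _ _ I); last 2 first.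
- by nia.
- exists 0 => //; split; try by upds.
    by do 3 (apply: env_upd; first by lia).
  by split; [upds; lia| |rewrite cats0|nia].
move=> f1 Z inp1 out1 [k kn [eZ z7 z8 z12 [z13 -> -> Gf1]]].
split; first by nia.
  move=> k0; have {}kn : k < n by lia.
  rewrite (_ : n - k = (n - k.+1).+1) ?mulSn in Gf1; last by lia.
  apply: (@write_entry_wp I (G + (n - k.+1) * (entry_cost + 1) + 3)
            _ _ _ _ _ _ _ _ eZ z7 z8 z12 z13 i_lt kn); first by lia.
  move=> f2 W Gf2 eW w7 w8 w12 w13; exists k.+1 => //; split=> //.
  split=> //; first by lia.
  by rewrite rcons_cat -map_rcons -cats1 -[k.+1]addn1 iotaD.
move=> k0; have kE : k = n by lia.
have [z1 _ _ _ _] := eZ.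
apply: wp_block => //=; first by nia.
upds; rewrite kE; apply: HQ.
- by nia.
- by do 2 (apply: env_upd; first by lia).
- by upds; lia.
- by upds; lia.
Qed.

Lemma write_matrix_wp (Q : assertion) G f X inp :
  env n pr X ->
  G + n * (n * (entry_cost + 1) + 11) + 10 <= f ->
  (forall f' X', G <= f' -> Q f' X' inp
     [seq nat_of_bool (res i j) | i <- iota 0 n, j <- iota 0 n]) ->
  wp write_matrix Q f X inp [::].
Proof.
move=> eX Gf HQ; have [x1 x2 _ _ [_ x6 _]] := eX.
apply: wp_seq; apply: wp_block => //=; first by nia.
upds; rewrite x2 x6 addn0.
pose I : assertion := fun f' X' inp' out' => exists2 k, k <= n &
  [/\ env n pr X', X' 7 = k, X' 12 = n - k, inp' = inp &
      out' = [seq nat_of_bool (res i j) | i <- iota 0 k, j <- iota 0 n] /\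
          G + (n - k) * (n * (entry_cost + 1) + 11) + 3 <= f'].
apply: (@wp_while _ _ I); last 2 first.
- by nia.
- exists 0 => //; split=> //; try by upds; lia.
    by do 3 (apply: env_upd; first by lia).
  by split=> //; nia.
move=> f1 Z inp1 out1 [k kn [eZ z7 z12 -> [-> Gf1]]].
split; first by nia.
  move=> k0; have {}kn : k < n by lia.
  rewrite (_ : n - k = (n - k.+1).+1) ?mulSn in Gf1; last by lia.
  apply: (@write_row_wp I (G + (n - k.+1) * (n * (entry_cost + 1) + 11) + 3)
            _ _ _ _ _ _ eZ z7 z12 kn); first by lia.
  move=> f2 W Gf2 eW w7 w12; exists k.+1 => //; split=> //; first by lia.
  split=> //.
  by rewrite -[k.+1]addn1 iotaD map_cat flatten_cat /= cats0.
move=> k0; have kE : k = n by lia.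
by rewrite kE; apply: HQ; nia.
Qed.

End Matrix.

(** * From encoded graphs to the theorem *)

Section GraphEncoding.

Variables (n : nat) (E : digraph n) (pl : 'I_n -> seq 'I_n).
Hypotheses (sc : strongly_connected E) (plE : predecessor_lists E pl).

Definition pred_lists : seq (seq nat) :=
  [seq [seq val u | u <- pl v] | v <- enum 'I_n].

Lemma size_pred_lists : size pred_lists = n.
Proof. by rewrite size_map size_enum_ord. Qed.

Lemma encode_pred_lists :
  encode_graph pl = size pred_lists :: encode_lists pred_lists.
Proof.
rewrite /encode_graph size_pred_lists /encode_lists /pred_lists -map_comp.
by congr (_ :: flatten _); apply: eq_map => v /=; rewrite size_map.
Qed.

Lemma nth_pred_lists (v : 'I_n) :
  nth [::] pred_lists v = [seq val u | u <- pl v].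
Proof. by rewrite (nth_map v) ?size_enum_ord // nth_ord_enum. Qed.

Lemma mem_pred_lists (u v : 'I_n) :
  (val u \in nth [::] pred_lists v) = ((u, v) \in E).
Proof. by rewrite nth_pred_lists mem_map ?(plE v).2 //; exact: val_inj. Qed.

Lemma pred_lists_lt u v :
  v < n -> u \in nth [::] pred_lists v -> u < n.
Proof.
move=> vn; rewrite (nth_pred_lists (Ordinal vn)) => /mapP [w _ ->].
exact: ltn_ord.
Qed.

Lemma sumn_pred_lists : sumn (map size pred_lists) = #|E|.
Proof.
rewrite /pred_lists -map_comp sumnE big_map big_enum /=.
rewrite -sum1_card (eq_bigl (fun a => (a.1, a.2) \in E)); last by case.
rewrite -(pair_big_dep predT (fun u v => (u, v) \in E) (fun _ _ => 1)) /=.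
rewrite (exchange_big_dep predT) //=; apply: eq_bigr => v _.
have [uq mem] := plE v.
rewrite size_map -(card_uniqP uq) sum1_card.
by apply: eq_card => u; rewrite mem unfold_in.
Qed.

Lemma pred_lists_reach (A : pred nat) i :
  i < n -> A i ->
  (forall u v, v < n -> u \in nth [::] pred_lists v -> A v -> A u) ->
  forall u, u < n -> A u.
Proof.
move=> i_lt Ai closed u un; apply/negPn/negP => Au.
have [||x [y [xy Ax /negPn Ay]]] :=
    @cut_crossed _ E (fun w => ~~ A w) (Ordinal un) (Ordinal i_lt) sc.
- exact: Au.
- by rewrite negbK.
by case/negP: Ax; apply: (closed x y) => //; rewrite mem_pred_lists.
Qed.

Lemma nat_cutP (i j : 'I_n) :
  (exists L, is_cut E i j L) <->
  exists L, nat_cut n (nth [::] pred_lists) i j L.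
Proof.
split=> [[L [Li Lj LE]]|[L [Li Lj LE]]].
  exists (fun m => if insub m is Some u then L u else false).
  split; rewrite ?valK // => u v vn uv.
  have un := pred_lists_lt vn uv; rewrite !(insubT (fun m => m < n)) => ui uj.
  by apply: LE => //; rewrite -mem_pred_lists.
exists (fun u => L u); split=> // u v uv ui uj.
by apply: LE; rewrite ?mem_pred_lists.
Qed.

(** With at least two nodes, strong connectivity gives every node a
    predecessor. *)
Lemma edges_ge_nodes : 1 < n -> n <= #|E|.
Proof.
move=> n1; rewrite -sumn_pred_lists -{1}size_pred_lists -(size_map size).
have : all (leq 1) (map size pred_lists).
  rewrite all_map; apply/allP => s /mapP [v _ ->] /=; rewrite size_map.
  have [u uv] : exists u, u != v.
    have i0 : 0 < n by lia.
    case: (eqVneq (Ordinal i0) v) => v0; last by exists (Ordinal i0).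
    by exists (Ordinal n1); rewrite -v0.
  have [||x [y [xy _ /negPn /eqP yv]]] := @cut_crossed _ E (predC1 v) u v sc.
  - exact: uv.
  - by rewrite /= eqxx.
  have [_ mem] := plE v; rewrite yv -mem in xy.
  by case: (pl v) xy.
by elim: (map size _) => //= a s IH /andP [a0 /IH]; lia.
Qed.

Lemma edges_le_square : #|E| <= n ^ 2.
Proof. by have := max_card (mem E); rewrite card_prod card_ord. Qed.

End GraphEncoding.

Definition cut_graph_program : program :=
  compile 0 (Seq read_graph write_matrix).

(** For at least two nodes [n <= m], so that every term is at most a multiple of
    [n ^ 2 * m]; the constant 1 on the right covers [n <= 1]. *)
Lemma time_bound n m :
  (1 < n -> n <= m) -> m <= n ^ 2 ->
  n * (n * (20 * m + 13 * n + 4 * n + 41) + 11) + 10 + 5 * m + 10 * n + 11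
    <= 200 * (n ^ 2 * m + 1).
Proof.
case: n => [|[|n]] nm mn; [lia|lia|have {}nm := nm isT].
set N := n.+2 in nm mn *; have N2 : 2 <= N by [].
have h : N * (20 * m + 13 * N + 4 * N + 41) <= N * (58 * m).
  by rewrite leq_mul2l; lia.
have h2 : N * (N * (20 * m + 13 * N + 4 * N + 41)) <= 58 * (N ^ 2 * m).
  rewrite expnS expn1 -mulnA [58 * _]mulnCA leq_mul2l /=.
  by rewrite (leq_trans h) // mulnCA.
have h3 : m <= N ^ 2 * m by rewrite leq_pmull // expn_gt0.
rewrite mulnDr; lia.
Qed.

Theorem mainTheorem5 :
  exists (P : program) (C : nat),
  forall (R : realType) (k : chain_kind) (n : nat) (E : digraph n)
         (pl : 'I_n -> seq 'I_n),
    strongly_connected E ->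
    predecessor_lists E pl ->
    computes_within P (encode_graph pl) (C * (n ^ 2 * #|E| + 1))
      (encode_rel (cut_graph R k E)).
Proof.
exists cut_graph_program, 200 => R k n E pl sc plE.
pose res i j := if (insub i, insub j) is (Some a, Some b)
  then cut_graph R k E a b else false.
have -> : encode_rel (cut_graph R k E) =
    [seq nat_of_bool (res i j) | i <- iota 0 n, j <- iota 0 n].
  rewrite /encode_rel -val_enum_ord allpairs_mapl allpairs_mapr.
  by apply: eq_allpairs => i j; rewrite /res !valK.
have res_cut i j : i < n -> j < n ->
    res i j <-> i != j /\ exists L, nat_cut n (nth [::] (pred_lists pl)) i j L.
  move=> i_lt j_lt; rewrite /res !insubT.
  have := nat_cutP plE (Ordinal i_lt) (Ordinal j_lt) => /= <-.
  case: (eqVneq i j) => [ij|ij].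
    by split=> [/andP [/eqP nij _]|[]] //; case: nij; exact: val_inj.
  have := @cut_graphP R k _ _ (Ordinal i_lt) (Ordinal j_lt) sc ij => ->.
  by split=> [|[]].
rewrite encode_pred_lists; set r := [seq _ | i <- _, j <- _].
apply: (@wp_computes _ _ _ (fun _ _ _ out => out = r)); last by [].
apply: wp_seq.
have szn := size_pred_lists pl.
apply: (@read_graph_wp _
   (n * (n * (entry_cost n (nth [::] (pred_lists pl)) + 1) + 11) + 10)).
  rewrite (sumn_pred_lists plE) szn.
  have -> : entry_cost n (nth [::] (pred_lists pl)) =
            20 * #|E| + 13 * n + 4 * n + 40.
    rewrite /entry_cost; congr (_ + _ + _).
    rewrite /potential big_split /= -big_distrr sum_nat_const.
    rewrite card_ord [n * _]mulnC; congr (_ * _ + _).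
    rewrite -(sumn_pred_lists plE) sumnE big_map /pred_lists big_map big_enum.
    by apply: eq_bigr => v _; rewrite nth_pred_lists.
  have := time_bound (edges_ge_nodes sc plE) (edges_le_square E).
  rewrite -!addnA; exact.
move=> f X Gf; rewrite szn => eX.
apply: (write_matrix_wp (pred_lists_lt (pl := pl))
         (pred_lists_reach sc plE) res_cut eX (G := 0)) => //.
Qed.
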